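(* Let $n\ge2$ be even. The finite quantum group $\mathbb{KP}_n$ admits $4n$ one-dimensional pairwise non-equivalent unitary representations, namely, for $l\in\{0,1,\dots,n-1\}$, \[\rho_l^\pm=\sum_{i,j\in\mathbb{Z}_n}\eta^{il}e_{(i,j)}\pm\sum_{i=1}^nE_{i,i+l},\qquad \sigma_l^\pm=\sum_{i,j\in\mathbb{Z}_n}(-1)^j\eta^{il}e_{(i,j)}\pm\sum_{i=1}^n(-1)^iE_{i,i+l}.\] It also admits $\frac{n(n-2)}2$ pairwise non-equivalent unitary two-dimensional irreducible representations $\mathfrak{X}^{u,v}$, indexed by $u\in\{0,1,\dots,n-1\}$ and $v\in\{1,2,\dots,\frac n2-1\}$, given by their matrix coefficients \[\mathfrak{X}^{u,v}_{11}=\sum_{i,j\in\mathbb{Z}_n}\eta^{iu+jv}e_{(i,j)},\qquad \mathfrak{X}^{u,v}_{12}=\sum_{i=1}^n\eta^{-iv}E_{i,i+u},\] \[\mathfrak{X}^{u,v}_{21}=\sum_{i=1}^n\eta^{iv}E_{i,i+u},\qquad \mathfrak{X}^{u,v}_{22}=\sum_{i,j\in\mathbb{Z}_n}\eta^{iu-jv}e_{(i,j)}.\]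
   Context: The Sekine finite quantum group $\mathbb{KP}_n=(\mathcal{A}_n,\Delta)$ ($n\ge2$): $\mathcal{A}_n=\bigoplus_{i,j\in\mathbb{Z}_n}\mathbb{C}e_{(i,j)}\oplus\mathcal{M}_n(\mathbb{C})$ is the multi-matrix $*$-algebra with usual multiplication and involution, with basis the minimal projections $e_{(i,j)}$, $i,j\in\mathbb{Z}_n$, and the matrix units $E_{i,j}$, $1\le i,j\le n$ (indices of $E$ read modulo $n$). With $\eta=e^{2\imath\pi/n}$, the coproduct $\Delta:\mathcal{A}_n\to\mathcal{A}_n\otimes\mathcal{A}_n$ is the linear map \[\Delta(e_{(i,j)})=\sum_{k,l\in\mathbb{Z}_n}e_{(k,l)}\otimes e_{(i-k,j-l)}+\frac1n\sum_{k,l\in\mathbb{Z}_n}\eta^{i(k-l)}E_{k,l}\otimes E_{k+j,l+j},\] \[\Delta(E_{i,j})=\sum_{k,l\in\mathbb{Z}_n}e_{(-k,-l)}\otimes\eta^{k(i-j)}E_{i-l,j-l}+\sum_{k,l\in\mathbb{Z}_n}\eta^{k(j-i)}E_{i-l,j-l}\otimes e_{(k,l)}.\] The counit is $\varepsilon\left(\sum x_{(i,j)}e_{(i,j)}+\sum X_{i,j}E_{i,j}\right)=x_{(0,0)}$. A ($d$-dimensional) representation of $\mathbb{KP}_n$ is an invertible matrix $w=(w_{ij})\in\mathcal{M}_d(\mathcal{A}_n)$ with $\Delta(w_{ij})=\sum_kw_{ik}\otimes w_{kj}$; it is unitary if $w$ is a unitary element of $\mathcal{M}_d(\mathcal{A}_n)$.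 A linear map $T$ intertwines $w$ and $w'$ if $(T\otimes1)w=w'(T\otimes1)$; $w,w'$ are equivalent if there is an invertible intertwiner; $w$ is irreducible if its only self-intertwiners are the scalar multiples of the identity. One-dimensional representations are identified with elements of $\mathcal{A}_n$. *)

(* Defs.v *)
From HB Require Import structures.
From mathcomp Require Import all_boot all_order all_algebra.
From mathcomp Require Import complex reals trigo.

Set Implicit Arguments.
Unset Strict Implicit.
Unset Printing Implicit Defensive.

Import GRing.Theory Num.Theory VectorInternalTheory.
Local Open Scope ring_scope.

(* The tensor product of two finite-dimensional spaces, in coordinates: the   *)
(* (a, b) entry of a tensor is its coefficient on the tensor product of the   *)
(* a-th and b-th vectors of the reference bases underlying v2r.               *)
Definition tensor (F : fieldType) (U V : vectType F) : vectType F :=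
  'M[F]_(dim U, dim V).

Definition tens (F : fieldType) (U V : vectType F) (u : U) (v : V) :
    tensor U V :=
  (v2r u)^T *m v2r v.

(* 'Z_n is Z/nZ only for n >= 2, which is assumed in all uses. The matrix     *)
(* block is indexed by 'Z_n (the index n of the usual range 1..n being 0).    *)
Definition sekine (R : realType) (n : nat) : Type :=
  ({ffun 'Z_n * 'Z_n -> R[i]^o} * 'M[R[i]]_((Zp_trunc n).+2))%type.

HB.instance Definition _ (R : realType) (n : nat) :=
  GRing.PzRing.copy (sekine R n)
    ({ffun 'Z_n * 'Z_n -> R[i]^o} * 'M[R[i]]_((Zp_trunc n).+2))%type.
HB.instance Definition _ (R : realType) (n : nat) :=
  Vector.copy (sekine R n)
    ({ffun 'Z_n * 'Z_n -> R[i]^o} * 'M[R[i]]_((Zp_trunc n).+2))%type.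

Section Sekine.
Variables (R : realType) (n : nat).
Local Notation C := R[i].
Local Notation A := (sekine R n).

Definition star (x : A) : A :=
  ([ffun ij => (x.1 ij)^*], \matrix_(i, j) (x.2 j i)^*).

Definition e_ (i j : 'Z_n) : A := ([ffun kl => (kl == (i, j))%:R], 0).

Definition E_ (i j : 'Z_n) : A := (0, delta_mx i j).

Definition eta : C :=
  (cos (pi *+ 2 / n%:R : R) +i* sin (pi *+ 2 / n%:R : R))%C.

(* eta ^ a for an exponent a mod n, through the representative 0 <= a < n *)
Definition etaX (a : 'Z_n) : C := eta ^+ a.

Definition comult_e (i j : 'Z_n) : tensor A A :=
  \sum_(k : 'Z_n) \sum_(l : 'Z_n) tens (e_ k l) (e_ (i - k) (j - l)) +
  n%:R^-1 *: \sum_(k : 'Z_n) \sum_(l : 'Z_n)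
    etaX (i * (k - l)) *: tens (E_ k l) (E_ (k + j) (l + j)).

Definition comult_E (i j : 'Z_n) : tensor A A :=
  \sum_(k : 'Z_n) \sum_(l : 'Z_n)
    tens (e_ (- k) (- l)) (etaX (k * (i - j)) *: E_ (i - l) (j - l)) +
  \sum_(k : 'Z_n) \sum_(l : 'Z_n)
    tens (etaX (k * (j - i)) *: E_ (i - l) (j - l)) (e_ k l).

Definition comult (x : A) : tensor A A :=
  \sum_(i : 'Z_n) \sum_(j : 'Z_n) x.1 (i, j) *: comult_e i j +
  \sum_(i : 'Z_n) \sum_(j : 'Z_n) x.2 i j *: comult_E i j.

Definition is_rep (d : nat) (w : 'M[A]_d) : Prop :=
  (exists w' : 'M[A]_d, w *m w' = 1%:M /\ w' *m w = 1%:M) /\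
  forall i j, comult (w i j) = \sum_(k < d) tens (w i k) (w k j).

Definition mxstar (d : nat) (w : 'M[A]_d) : 'M[A]_d :=
  \matrix_(i, j) star (w j i).

Definition unitary_mat (d : nat) (w : 'M[A]_d) : Prop :=
  w *m mxstar w = 1%:M /\ mxstar w *m w = 1%:M.

(* the matrix T (x) 1 *)
Definition scalar_ext (d d' : nat) (T : 'M[C]_(d', d)) : 'M[A]_(d', d) :=
  \matrix_(i, j) (T i j *: (1 : A)).

Definition intertwines (d d' : nat) (w : 'M[A]_d) (w' : 'M[A]_d')
    (T : 'M[C]_(d', d)) : Prop :=
  scalar_ext T *m w = w' *m scalar_ext T.

Definition equivalent (d d' : nat) (w : 'M[A]_d) (w' : 'M[A]_d') : Prop :=
  exists (T : 'M[C]_(d', d)) (S : 'M[C]_(d, d')),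
    [/\ T *m S = 1%:M, S *m T = 1%:M & intertwines w w' T].

Definition irreducible (d : nat) (w : 'M[A]_d) : Prop :=
  forall T : 'M[C]_d, intertwines w w T -> exists c : C, T = c%:M.

Definition dim1 (a : A) : 'M[A]_1 := const_mx a.

(* The sign is + for s = false and - for s = true. *)
Definition rho (s : bool) (l : 'Z_n) : A :=
  \sum_(i : 'Z_n) \sum_(j : 'Z_n) etaX (i * l) *: e_ i j +
  (-1) ^+ s *: \sum_(i : 'Z_n) E_ i (i + l).

(* For n even, (-1)^i depends only on i mod n. *)
Definition sigma (s : bool) (l : 'Z_n) : A :=
  \sum_(i : 'Z_n) \sum_(j : 'Z_n) ((-1) ^+ j * etaX (i * l)) *: e_ i j +
  (-1) ^+ s *: \sum_(i : 'Z_n) (-1) ^+ i *: E_ i (i + l).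

Definition rho_sigma (p : bool * bool * 'Z_n) : A :=
  let: (is_sigma, s, l) := p in if is_sigma then sigma s l else rho s l.

Definition X11 (u v : 'Z_n) : A :=
  \sum_(i : 'Z_n) \sum_(j : 'Z_n) etaX (i * u + j * v) *: e_ i j.
Definition X12 (u v : 'Z_n) : A :=
  \sum_(i : 'Z_n) etaX (- (i * v)) *: E_ i (i + u).
Definition X21 (u v : 'Z_n) : A :=
  \sum_(i : 'Z_n) etaX (i * v) *: E_ i (i + u).
Definition X22 (u v : 'Z_n) : A :=
  \sum_(i : 'Z_n) \sum_(j : 'Z_n) etaX (i * u - j * v) *: e_ i j.

Definition frakX (p : 'Z_n * 'Z_n) : 'M[A]_2 :=
  \matrix_(a, b)
    if a == 0 then (if b == 0 then X11 p.1 p.2 else X12 p.1 p.2)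
    else (if b == 0 then X21 p.1 p.2 else X22 p.1 p.2).

Definition X_index : {set 'Z_n * 'Z_n} :=
  [set p : 'Z_n * 'Z_n | (1 <= p.2 <= n./2 - 1)%N].

End Sekine.

(* Main.v *)
From HB Require Import structures.
Require Import Defs.
From mathcomp Require Import all_boot all_order all_algebra.
From mathcomp Require Import complex reals trigo.
From mathcomp Require Import ring lra zify.

Set Implicit Arguments.
Unset Strict Implicit.
Unset Printing Implicit Defensive.

Import Order.TTheory GRing.Theory Num.Theory VectorInternalTheory.
Local Open Scope ring_scope.

(** The representations all come from the dihedral group D of order 2n, whose
    rotations t_j and reflections s_k (j, k in Z/n) multiply by
      t_i t_j = t_(i+j),  s_i t_j = s_(i+j),  t_i s_j = s_(j-i),
      s_i s_j = t_(j-i).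
    Fix u in Z/n and send a function f on D to the element
      sum_(i,j) eta^(iu) f(t_j) e_(i,j) + sum_k f(s_k) E_(k,k+u)
    of the Sekine algebra ([lift_fun]). The two halves of this sum see the
    rotations and the reflections, and the formula for the coproduct of KP_n
    becomes the coproduct f |-> ((x, y) |-> f (x y)) of functions on D: the
    sum over i of eta^(iu) times the E (x) E terms of the coproduct of e_(i,j)
    is an orthogonality relation that keeps only E_(k,k+u) (x) E_(k+j,k+j+u),
    i.e. the factorizations t_j = s_k s_(k+j) ([comult_lift]).

    Applying this entrywise, a matrix representation W of D and a twist u give
    a matrix over the Sekine algebra which satisfies the representation
    identity and is unitary as soon as every W x is ([comult_lift_mx],
    [lift_mx_unitary]). An intertwiner of two lifts, compared at e_(1,0),
    satisfies eta^u T = eta^u' T, so that a nonzero one forces u = u', and it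
    is then an intertwiner of the representations of D ([intertwines_lift],
    [intertwines_twist_eq]).

    What remains is classical: for n even, D has the four characters
    t_j |-> (+-1)^j, s_k |-> +- (+-1)^k, whose lifts are the rho and sigma, and
    the representations induced from t_j |-> eta^(jv), whose lifts are the
    matrices X. An operator intertwining the induced representations of v and
    v' has vanishing off-diagonal entries if v + v' <> 0, vanishing diagonal
    entries if v <> v', and equal diagonal entries in any case
    ([dihedral_rep2_intw]). For 1 <= v, v' < n/2 the sum v + v' is never 0 in
    Z/n, which gives irreducibility and inequivalence. *)

(** * Characters of the cyclic group *)

Section UnityRoot.
Variables (K : pzRingType) (n : nat).
Hypothesis n_gt1 : (1 < n)%N.
Variable z : K.
Hypothesis zn1 : z ^+ n = 1.

Lemma unity_exprD (a b : 'Z_n) : z ^+ (a + b)%R = z ^+ a * z ^+ b.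
Proof. by rewrite -exprD; apply: expr_mod; rewrite Zp_cast. Qed.

Lemma unity_exprNr (a : 'Z_n) : z ^+ a * z ^+ (- a)%R = 1.
Proof. by rewrite -unity_exprD subrr expr0. Qed.

End UnityRoot.

Lemma unity_exprC (C : numClosedFieldType) (n : nat) (z : C) (a : 'Z_n) :
  (1 < n)%N -> z ^+ n = 1 -> (z ^+ a)^* = z ^+ (- a)%R.
Proof.
move=> n_gt1 zn1.
have z_norm : `|z| = 1.
  apply/eqP; rewrite -(@pexpr_eq1 _ _ n) ?normr_ge0 //; last exact: ltnW.
  by rewrite -normrX zn1 normr1.
have za0 : z ^+ a != 0 by rewrite -normr_eq0 normrX z_norm expr1n oner_neq0.
apply: (mulfI za0); rewrite unity_exprNr //.
by rewrite -normCK normrX z_norm !expr1n.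
Qed.

Section Eta.
Variables (R : realType) (n : nat).
Local Notation theta := (pi *+ 2 / n%:R : R).

(** De Moivre's formula. *)
Lemma etaE (k : nat) : eta R n ^+ k =
  (cos (k%:R * theta) +i* sin (k%:R * theta))%C.
Proof.
elim: k => [|k IHk]; first by rewrite expr0 mul0r cos0 sin0.
rewrite exprS IHk /eta -natr1 [(k%:R + 1) * _]mulrDl [1 * theta]mul1r cosD sinD.
by apply/eqP; rewrite eq_complex /=; apply/andP; split; apply/eqP; ring.
Qed.

Hypothesis n_gt1 : (1 < n)%N.

Lemma eta_expn : eta R n ^+ n = 1.
Proof.
have n0 : n%:R != 0 :> R by rewrite pnatr_eq0 -lt0n ltnW.
by rewrite etaE mulrC divfK // cos2pi sin2pi.
Qed.

(** If eta ^ a = 1 then cos (2 x) = 1 for x = pi a / n in [0, pi), so that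
    sin x = 0, and the sine does not vanish on (0, pi). *)
Lemma etaX_eq1 (a : 'Z_n) : etaX R a = 1 -> a = 0.
Proof.
move=> ea; apply/eqP/negPn/negP => a0.
have n0 : 0 < n%:R :> R by rewrite ltr0n ltnW.
have a_gt0 : 0 < a%:R :> R by rewrite ltr0n lt0n.
have a_lt : a%:R < n%:R :> R.
  by rewrite ltr_nat -[X in (_ < X)%N](Zp_cast n_gt1) ltn_ord.
have sx : 0 < sin (a%:R / n%:R * pi : R).
  apply: sin_gt0_pi; rewrite mulr_gt0 ?pi_gt0 ?divr_gt0 //=.
  by rewrite -[ltRHS]mul1r ltr_pM2r ?pi_gt0 // ltr_pdivrMr ?mul1r.
have := congr1 (@complex.Re R) ea; rewrite /etaX etaE /=.
have -> : a%:R * theta = (a%:R / n%:R * pi) *+ 2 by ring.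
rewrite cos_mulr2n => c1.
have := cos2Dsin2 (a%:R / n%:R * pi : R) => cs.
have := exprn_gt0 2 sx; lra.
Qed.

Local Notation etaX := (@etaX R n).

Lemma etaXD (a b : 'Z_n) : etaX (a + b) = etaX a * etaX b.
Proof. by rewrite /etaX unity_exprD // eta_expn. Qed.

Lemma etaX0 : etaX 0 = 1.
Proof. by []. Qed.

Lemma etaXN (a : 'Z_n) : etaX a * etaX (- a) = 1.
Proof. by rewrite -etaXD subrr. Qed.

Lemma etaX_conj (a : 'Z_n) : (etaX a)^* = etaX (- a).
Proof. exact: (unity_exprC a n_gt1 eta_expn). Qed.

Lemma etaX_inj : injective etaX.
Proof.
move=> a b eab; apply/subr0_eq/etaX_eq1.
by rewrite etaXD eab etaXN.
Qed.

Lemma card_Zn : #|'Z_n| = n.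
Proof. by rewrite card_ord Zp_cast. Qed.

(** Orthogonality of characters: the sum is unchanged when multiplied by
    eta ^ a, which is not 1 unless a = 0. *)
Lemma sum_etaX (a : 'Z_n) :
  \sum_(i : 'Z_n) etaX (i * a) = (if a == 0 then n%:R else 0).
Proof.
case: eqP => [->|/eqP a0].
  under eq_bigr do rewrite mulr0 etaX0.
  by rewrite sumr_const card_Zn.
set S := \sum_i _.
have S_shift : S * etaX a = S.
  rewrite mulr_suml [RHS](reindex_inj (addIr 1)) /=.
  by apply: eq_bigr => i _; rewrite -etaXD mulrDl mul1r.
have /eqP : S * (etaX a - 1) = 0 by rewrite mulrBr S_shift mulr1 subrr.
rewrite mulf_eq0 subr_eq0 => /orP[/eqP //|/eqP /etaX_eq1 /eqP].
by rewrite (negPf a0).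
Qed.

End Eta.

(** * Dihedral functions inside the Sekine algebra *)

Section Tens.
Variables (F : fieldType) (U V : vectType F).

Lemma tens_suml (I : finType) (f : I -> U) (v : V) :
  tens (\sum_i f i) v = \sum_i tens (f i) v.
Proof. by rewrite /tens !linear_sum mulmx_suml. Qed.

Lemma tens_sumr (I : finType) (u : U) (f : I -> V) :
  tens u (\sum_i f i) = \sum_i tens u (f i).
Proof. by rewrite /tens linear_sum mulmx_sumr. Qed.

Lemma tensZl (c : F) (u : U) (v : V) : tens (c *: u) v = c *: tens u v.
Proof. by rewrite /tens !linearZ /= -scalemxAl. Qed.

Lemma tensZr (c : F) (u : U) (v : V) : tens u (c *: v) = c *: tens u v.
Proof. by rewrite /tens linearZ /= -scalemxAr. Qed.

End Tens.

Section Dihedral.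
Variable n : nat.

Definition dihedral : Type := (bool * 'Z_n)%type.
HB.instance Definition _ := Finite.copy dihedral (bool * 'Z_n)%type.

Definition rotation (j : 'Z_n) : dihedral := (false, j).
Definition reflection (k : 'Z_n) : dihedral := (true, k).

(** The order of the two arguments in the difference is the one for which
    s_k s_(k+j) = t_j, matching the term E_(k,l) (x) E_(k+j,l+j) in the
    coproduct of e_(i,j). *)
Definition dmul (x y : dihedral) : dihedral :=
  (x.1 (+) y.1, if y.1 then y.2 - x.2 else x.2 + y.2).

Lemma sum_dihedral (V : nmodType) (f : dihedral -> V) :
  \sum_x f x = \sum_j f (rotation j) + \sum_k f (reflection k).
Proof.
rewrite addrC -(big_bool _ (fun b => \sum_j f (b, j))) pair_bigA /=.
by apply: eq_bigr => -[].
Qed.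

(** Grouping the pairs (x, y) by their product: the right-hand side lists the
    factorizations of each rotation and of each reflection. *)
Lemma sum_dmul (K : pzRingType) (V : lmodType K) (f : dihedral -> K)
    (t : dihedral -> dihedral -> V) :
  \sum_x \sum_y f (dmul x y) *: t x y =
  \sum_j f (rotation j) *: (\sum_l t (rotation l) (rotation (j - l)) +
                       \sum_k t (reflection k) (reflection (k + j))) +
  \sum_k f (reflection k) *: (\sum_l t (rotation l) (reflection (k + l)) +
                        \sum_l t (reflection (k - l)) (rotation l)).
Proof.
pose block b c := \sum_i \sum_j f (dmul (b, i) (c, j)) *: t (b, i) (c, j).
have -> : \sum_x \sum_y f (dmul x y) *: t x y =
    (block false false + block false true) + (block true false + block true true).
  rewrite sum_dihedral; congr (_ + _); rewrite -big_split;
    by apply: eq_bigr => i _; rewrite sum_dihedral.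
have -> : block false false = \sum_j f (rotation j) *: \sum_l t (rotation l) (rotation (j - l)).
  under [RHS]eq_bigr do rewrite scaler_sumr.
  rewrite [RHS]exchange_big; apply: eq_bigr => l _.
  rewrite [RHS](reindex_inj (addrI l)); apply: eq_bigr => j _ /=.
  by rewrite [l + j - l]addrAC subrr add0r.
have -> : block true true = \sum_j f (rotation j) *: \sum_k t (reflection k) (reflection (k + j)).
  under [RHS]eq_bigr do rewrite scaler_sumr.
  rewrite [RHS]exchange_big; apply: eq_bigr => l _.
  rewrite /= (reindex_inj (addrI l)); apply: eq_bigr => j _ /=.
  by rewrite /dmul /= [l + j - l]addrAC subrr add0r.
have -> : block false true = \sum_k f (reflection k) *: \sum_l t (rotation l) (reflection (k + l)).
  under [RHS]eq_bigr do rewrite scaler_sumr.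
  rewrite [RHS]exchange_big; apply: eq_bigr => l _.
  rewrite /= (reindex_inj (addIr l)); apply: eq_bigr => j _ /=.
  by rewrite /dmul /= addrK.
have -> : block true false = \sum_k f (reflection k) *: \sum_l t (reflection (k - l)) (rotation l).
  under [RHS]eq_bigr do rewrite scaler_sumr.
  rewrite [RHS]exchange_big /block [LHS]exchange_big; apply: eq_bigr => l _.
  rewrite [RHS](reindex_inj (addIr l)); apply: eq_bigr => j _ /=.
  by rewrite addrK.
under [X in _ = X + _]eq_bigr do rewrite scalerDr.
under [X in _ = _ + X]eq_bigr do rewrite scalerDr.
by rewrite !big_split /= [X in _ + X = _]addrC addrACA.
Qed.

End Dihedral.

Section Lift.
Variables (R : realType) (n : nat).
Hypothesis n_gt1 : (1 < n)%N.
Local Notation C := R[i].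
Local Notation A := (sekine R n).
Local Notation D := (dihedral n).
Local Notation etaX := (@etaX R n).

(** The lift of the indicator function of x. *)
Definition delta_lift (u : 'Z_n) (x : D) : A :=
  if x.1 then E_ R x.2 (x.2 + u) else \sum_(i : 'Z_n) etaX (i * u) *: e_ R i x.2.

Definition lift_fun (u : 'Z_n) (f : D -> C) : A := \sum_x f x *: delta_lift u x.

Lemma sekine1_sum (I : finType) (f : I -> A) p :
  (\sum_i f i).1 p = \sum_i (f i).1 p.
Proof. by elim/big_rec2: _ => [|i y1 y2 _ <-]; rewrite /= ffunE. Qed.

Lemma sekine2_sum (I : finType) (f : I -> A) i j :
  (\sum_k f k).2 i j = \sum_k (f k).2 i j.
Proof. by elim/big_rec2: _ => [|k y1 y2 _ <-]; rewrite /= mxE. Qed.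

Lemma lift_e u f i j : (lift_fun u f).1 (i, j) = etaX (i * u) * f (rotation j).
Proof.
rewrite /lift_fun sum_dihedral /= ffunE !sekine1_sum.
rewrite [X in _ + X]big1 => [|k _]; last by rewrite !ffunE scaler0.
rewrite addr0 (bigD1 j) //= [X in _ + X]big1 => [|k kj]; last first.
  rewrite ffunE sekine1_sum big1 ?scaler0 // => a _.
  by rewrite !ffunE xpair_eqE eq_sym [j == k]eq_sym (negPf kj) andbF scaler0.
rewrite addr0 ffunE sekine1_sum (bigD1 i) //= big1 => [|k ki]; last first.
  by rewrite !ffunE xpair_eqE eq_sym (negPf ki) scaler0.
by rewrite !ffunE eqxx addr0 /GRing.scale /= mulr1 mulrC.
Qed.

Lemma lift_E u f i j :
  (lift_fun u f).2 i j = (if j == i + u then f (reflection i) else 0).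
Proof.
rewrite /lift_fun sum_dihedral /= mxE !sekine2_sum.
rewrite [X in X + _]big1 => [|k _]; last first.
  rewrite mxE sekine2_sum big1 ?mulr0 // => a _.
  by rewrite !mxE mulr0.
rewrite add0r (bigD1 i) //= [X in _ + X]big1 => [|k ki]; last first.
  by rewrite !mxE eq_sym (negPf ki) mulr0.
by rewrite !mxE eqxx addr0 /=; case: eqP; rewrite ?mulr1 ?mulr0.
Qed.

(** The terms on the right are the factorizations t_j = t_l t_(j-l) and
    t_j = s_k s_(k+j). *)
Lemma comult_e_delta u j :
  \sum_i etaX (i * u) *: comult_e R i j =
  \sum_l tens (delta_lift u (rotation l)) (delta_lift u (rotation (j - l))) +
  \sum_k tens (delta_lift u (reflection k)) (delta_lift u (reflection (k + j))).
Proof.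
have n0 : n%:R != 0 :> C by rewrite pnatr_eq0 -lt0n ltnW.
rewrite /comult_e; under eq_bigr do rewrite scalerDr.
rewrite big_split /=; congr (_ + _).
  under eq_bigr => i _.
    rewrite exchange_big scaler_sumr; under eq_bigr do rewrite scaler_sumr.
    over.
  rewrite exchange_big; apply: eq_bigr => l _.
  rewrite exchange_big /delta_lift tens_suml; apply: eq_bigr => k _ /=.
  rewrite tens_sumr (reindex_inj (addIr k)) /=; apply: eq_bigr => i _.
  by rewrite addrK tensZl tensZr scalerA mulrDl addrC etaXD.
under eq_bigr do rewrite scalerA scaler_sumr.
rewrite exchange_big; apply: eq_bigr => k _ /=.
under eq_bigr do rewrite scaler_sumr.
rewrite exchange_big /=.
(* the sum over i is an orthogonality relation selecting l = k + u *)
have select l : \sum_i (etaX (i * u) / n%:R) *: (etaX (i * (k - l)) *: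
      tens (E_ R k l) (E_ R (k + j) (l + j))) =
    (if l == k + u then 1 else 0) *: tens (E_ R k l) (E_ R (k + j) (l + j)).
  under eq_bigr do rewrite scalerA mulrAC -etaXD // -mulrDr.
  rewrite -scaler_suml -mulr_suml sum_etaX // addrA [u + k]addrC.
  rewrite subr_eq0 [k + u == l]eq_sym.
  by case: eqP => _; rewrite ?mul0r // divff.
rewrite (eq_bigr _ (fun l _ => select l)) (bigD1 (k + u)) //=.
rewrite big1 => [|l /negPf->]; last by rewrite scale0r.
by rewrite eqxx scale1r addr0 /delta_lift /= addrAC.
Qed.

(** Likewise s_k = t_l s_(k+l) and s_k = s_(k-l) t_l. *)
Lemma comult_E_delta u k :
  comult_E R k (k + u) =
  \sum_l tens (delta_lift u (rotation l)) (delta_lift u (reflection (k + l))) +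
  \sum_l tens (delta_lift u (reflection (k - l))) (delta_lift u (rotation l)).
Proof.
rewrite /comult_E; congr (_ + _); rewrite exchange_big /=.
  rewrite (reindex_inj oppr_inj); apply: eq_bigr => l _ /=.
  rewrite (reindex_inj oppr_inj) tens_suml; apply: eq_bigr => i _ /=.
  rewrite !opprK opprD addrA subrr sub0r mulrNN tensZl tensZr.
  by rewrite /delta_lift /= addrAC.
apply: eq_bigr => l _; rewrite tens_sumr; apply: eq_bigr => i _.
by rewrite tensZl tensZr addrAC subrr add0r /delta_lift /= addrAC.
Qed.

(** For each u the span of the lifted indicator functions is a subcoalgebra,
    isomorphic to the coalgebra of functions on the dihedral group. *)
Lemma comult_lift u (f : D -> C) :
  comult (lift_fun u f) =
  \sum_x \sum_y f (dmul x y) *: tens (delta_lift u x) (delta_lift u y).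
Proof.
have rotE : \sum_i \sum_j (lift_fun u f).1 (i, j) *: comult_e R i j =
    \sum_j f (rotation j) *: \sum_i etaX (i * u) *: comult_e R i j.
  rewrite exchange_big; apply: eq_bigr => j _; rewrite scaler_sumr.
  by apply: eq_bigr => i _; rewrite lift_e scalerA mulrC.
have reflE : \sum_i \sum_j (lift_fun u f).2 i j *: comult_E R i j =
    \sum_k f (reflection k) *: comult_E R k (k + u).
  apply: eq_bigr => k _; rewrite (bigD1 (k + u)) //= big1 => [|j kj].
    by rewrite lift_E eqxx addr0.
  by rewrite lift_E (negPf kj) scale0r.
rewrite /comult rotE reflE sum_dmul; congr (_ + _); apply: eq_bigr => j _.
  by rewrite comult_e_delta.
by rewrite comult_E_delta.
Qed.

Lemma lift_expand u (f : D -> C) :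
  lift_fun u f = \sum_i \sum_j (etaX (i * u) * f (rotation j)) *: e_ R i j +
             \sum_k f (reflection k) *: E_ R k (k + u).
Proof.
rewrite /lift_fun sum_dihedral; congr (_ + _); rewrite exchange_big /=.
apply: eq_bigr => j _; rewrite scaler_sumr; apply: eq_bigr => i _.
by rewrite scalerA mulrC.
Qed.

Lemma sekine_eq (x y : A) :
  (forall i j, x.1 (i, j) = y.1 (i, j)) -> (forall i j, x.2 i j = y.2 i j) ->
  x = y.
Proof.
case: x y => [x X] [y Y] /= exy eXY; congr (_, _); last exact/matrixP.
by apply/ffunP => -[i j].
Qed.

Lemma sekine_mul1 (x y : A) p : (x * y).1 p = x.1 p * y.1 p.
Proof. by rewrite /= ffunE. Qed.

Lemma sekine_mul2 (x y : A) i j : (x * y).2 i j = \sum_k x.2 i k * y.2 k j.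
Proof. by rewrite /= mxE. Qed.

Lemma sekine_scalar_mul (c : C) (x : A) : (c *: (1 : A)) * x = c *: x.
Proof.
apply: sekine_eq => i j; first by rewrite sekine_mul1 /= !ffunE /GRing.scale /= mulr1.
rewrite [LHS]sekine_mul2 (bigD1 i) //= big1 => [|k ki].
  by rewrite !mxE eqxx mulr1 addr0.
by rewrite !mxE eq_sym (negPf ki) mulr0 mul0r.
Qed.

Lemma sekine_mul_scalar (c : C) (x : A) : x * (c *: (1 : A)) = c *: x.
Proof.
apply: sekine_eq => i j.
  by rewrite sekine_mul1 /= !ffunE /GRing.scale /= mulr1 mulrC.
rewrite [LHS]sekine_mul2 (bigD1 j) //= big1 => [|k kj].
  by rewrite !mxE eqxx mulr1 addr0 mulrC.
by rewrite !mxE (negPf kj) mulr0 mulr0.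
Qed.

(** * Lifted matrix representations and their intertwiners *)

Section LiftMatrix.
Variables (d : nat) (u : 'Z_n) (W : D -> 'M[C]_d).

Definition lift_mx : 'M[A]_d := \matrix_(a, b) lift_fun u (fun x => W x a b).

Lemma comult_lift_mx :
  (forall x y, W (dmul x y) = W x *m W y) ->
  forall a b, comult (lift_mx a b) = \sum_(c < d) tens (lift_mx a c) (lift_mx c b).
Proof.
move=> WM a b; rewrite mxE comult_lift //.
under [RHS]eq_bigr => c _.
  rewrite !mxE tens_suml; under eq_bigr => x _.
    rewrite tens_sumr; under eq_bigr do rewrite tensZl tensZr scalerA.
    over.
  over.
rewrite [RHS]exchange_big; apply: eq_bigr => x _ /=.
rewrite [RHS]exchange_big; apply: eq_bigr => y _ /=.
by rewrite WM mxE scaler_suml.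
Qed.

Hypothesis W_unitary : forall x, W x \is unitarymx.

Let W_row x a b : \sum_c W x a c * (W x b c)^* = (a == b)%:R.
Proof.
have /unitarymxP/matrixP/(_ a b) := W_unitary x.
by rewrite !mxE => <-; apply: eq_bigr => c _; rewrite !mxE.
Qed.

Let W_col x a b : \sum_c (W x c a)^* * W x c b = (a == b)%:R.
Proof.
have /unitarymxP/mulmx1C/matrixP/(_ a b) := W_unitary x.
by rewrite !mxE => <-; apply: eq_bigr => c _; rewrite !mxE.
Qed.

Let etaX_mul_conj i : etaX i * (etaX i)^* = 1.
Proof. by rewrite etaX_conj // etaXN. Qed.

(** Both products with the adjoint can be read off pointwise on the dihedral
    group. The (i, i) entry of the matrix block is governed by s_i in w w^* and
    by s_(i-u) in w^* w, since the block of a lift is supported on the pairs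
    (i, i + u). *)
Lemma lift_mx_unitary : unitary_mat lift_mx.
Proof.
have one1 a b p : ((1%:M : 'M[A]_d) a b).1 p = (a == b)%:R.
  by rewrite mxE; case: eqP => _; rewrite /= ffunE.
have one2 a b i j : ((1%:M : 'M[A]_d) a b).2 i j = (a == b)%:R * (i == j)%:R.
  by rewrite mxE; case: eqP => _; rewrite /= mxE ?mul0r ?mul1r.
split; apply/matrixP => a b; apply: sekine_eq => i j; rewrite (one1, one2) mxE.
- rewrite sekine1_sum -(W_row (rotation j) a b); apply: eq_bigr => c _.
  rewrite sekine_mul1 !mxE lift_e ffunE lift_e rmorphM mulrACA.
  by rewrite etaX_mul_conj mul1r.
- rewrite sekine2_sum -(W_row (reflection i) a b) mulr_suml; apply: eq_bigr => c _.
  rewrite sekine_mul2 (bigD1 (i + u)) //= big1 => [|k kiu].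
    rewrite addr0 !mxE !lift_E eqxx (inj_eq (addIr u)).
    by case: eqP => [->|_]; rewrite ?mulr1 ?conjC0 ?mulr0.
  by rewrite !mxE lift_E (negPf kiu) mul0r.
- rewrite sekine1_sum -(W_col (rotation j) a b); apply: eq_bigr => c _.
  rewrite sekine_mul1 !mxE lift_e ffunE lift_e rmorphM mulrACA.
  by rewrite [_^* * etaX _]mulrC etaX_mul_conj mul1r.
rewrite sekine2_sum -(W_col (reflection (i - u)) a b) mulr_suml; apply: eq_bigr => c _.
rewrite sekine_mul2 (bigD1 (i - u)) //= big1 => [|k kiu].
  rewrite addr0 !mxE !lift_E subrK eqxx [j == i]eq_sym.
  by case: eqP => [->|_]; rewrite ?mulr1 ?mulr0.
by rewrite !mxE lift_E -subr_eq eq_sym (negPf kiu) conjC0 mul0r.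
Qed.

Lemma lift_mx_rep : (forall x y, W (dmul x y) = W x *m W y) -> is_rep lift_mx.
Proof.
move=> WM; split; last exact: comult_lift_mx.
by exists (mxstar lift_mx); apply: lift_mx_unitary.
Qed.

End LiftMatrix.

Section LiftIntertwiner.
Variables (d d' : nat) (u u' : 'Z_n).
Variables (W : D -> 'M[C]_d) (W' : D -> 'M[C]_d') (T : 'M[C]_(d', d)).
Hypothesis T_intw : intertwines (lift_mx u W) (lift_mx u' W') T.

Let intw_entry a b : \sum_c T a c *: lift_fun u (fun x => W x c b) =
  \sum_c T c b *: lift_fun u' (fun x => W' x a c).
Proof.
have /matrixP/(_ a b) := T_intw; rewrite !mxE.
under eq_bigr do rewrite !mxE sekine_scalar_mul.
by under [RHS]eq_bigr do rewrite !mxE sekine_mul_scalar.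
Qed.

Lemma intertwines_rot i j :
  etaX (i * u) *: (T *m W (rotation j)) = etaX (i * u') *: (W' (rotation j) *m T).
Proof.
apply/matrixP => a b; rewrite !mxE !mulr_sumr.
have := congr1 (fun x : A => x.1 (i, j)) (intw_entry a b).
rewrite !sekine1_sum => eq_ij.
transitivity (\sum_c (T a c *: lift_fun u (fun x => W x c b)).1 (i, j)).
  by apply: eq_bigr => c _; rewrite ffunE lift_e mulrCA.
rewrite eq_ij; apply: eq_bigr => c _; rewrite ffunE lift_e /GRing.scale /=.
by rewrite mulrCA [T _ _ * _]mulrC.
Qed.

Lemma intertwines_refl k : u = u' -> T *m W (reflection k) = W' (reflection k) *m T.
Proof.
move=> uu'; apply/matrixP => a b; rewrite !mxE.
have := congr1 (fun x : A => x.2 k (k + u)) (intw_entry a b).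
rewrite !sekine2_sum => eq_k.
transitivity (\sum_c (T a c *: lift_fun u (fun x => W x c b)).2 k (k + u)).
  by apply: eq_bigr => c _; rewrite mxE lift_E eqxx.
rewrite eq_k; apply: eq_bigr => c _; rewrite mxE lift_E uu' eqxx.
by rewrite mulrC.
Qed.

Lemma intertwines_lift x : u = u' -> T *m W x = W' x *m T.
Proof.
case: x => -[] j uu'; first exact: intertwines_refl.
by have := intertwines_rot 0 j; rewrite !mul0r !etaX0 !scale1r.
Qed.

Hypotheses (W1 : W (rotation 0) = 1%:M) (W'1 : W' (rotation 0) = 1%:M).

(** At e_(1,0) both representations of the dihedral group are the identity, so
    only the scalars eta^u and eta^u' are left. *)
Lemma intertwines_twist_eq : T != 0 -> u = u'.
Proof.
have := intertwines_rot 1 0; rewrite W1 W'1 mulmx1 mul1mx !mul1r => /eqP.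
rewrite -subr_eq0 -scalerBl scaler_eq0 => /orP[|/eqP->]; last by rewrite eqxx.
by rewrite subr_eq0 => /eqP /(etaX_inj n_gt1).
Qed.

End LiftIntertwiner.
End Lift.

(** * Representations of the dihedral group *)

Lemma eq_mx2 (K : Type) (M N : 'M[K]_2) :
  M 0 0 = N 0 0 -> M 0 1 = N 0 1 -> M 1 0 = N 1 0 -> M 1 1 = N 1 1 -> M = N.
Proof.
have ord2P (a : 'I_2) : a = 0 \/ a = 1.
  by case: a => [[|[|//]] ?]; [left | right]; apply/val_inj.
move=> eq00 eq01 eq10 eq11; apply/matrixP => a b.
by case: (ord2P a) => ->; case: (ord2P b) => ->.
Qed.

Section DihedralRep.
Variables (R : realType) (n : nat).
Hypothesis n_gt1 : (1 < n)%N.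
Local Notation C := R[i].
Local Notation A := (sekine R n).
Local Notation D := (dihedral n).
Local Notation etaX := (@etaX R n).

Definition dihedral_char (b s : bool) (x : D) : 'M[C]_1 :=
  ((-1) ^+ (s && x.1) * ((-1) ^+ b) ^+ x.2)%:M.

(** The representation induced from the character t_j |-> eta^(jv). *)
Definition dihedral_rep2 (v : 'Z_n) (x : D) : 'M[C]_2 :=
  \matrix_(a, b) if (a == b) (+) x.1
                 then etaX (if b == 0 then x.2 * v else - (x.2 * v)) else 0.

Lemma lift_dihedral_char b s l :
  lift_mx l (dihedral_char b s) = dim1 (rho_sigma R (b, s, l)).
Proof.
apply/matrixP => a c; rewrite !mxE !ord1 lift_expand //.
case: b; rewrite /rho_sigma /rho /sigma scaler_sumr; congr (_ + _).
- apply: eq_bigr => i _; apply: eq_bigr => j _.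
  by rewrite /dihedral_char !mxE /= andbF mul1r mulrC.
- by apply: eq_bigr => k _; rewrite /dihedral_char !mxE /= andbT scalerA.
- apply: eq_bigr => i _; apply: eq_bigr => j _.
  by rewrite /dihedral_char !mxE /= andbF mul1r expr1n mulr1.
by apply: eq_bigr => k _; rewrite /dihedral_char !mxE /= andbT expr1n mulr1.
Qed.

Lemma lift_dihedral_rep2 p : lift_mx p.1 (dihedral_rep2 p.2) = frakX R p.
Proof.
have sum0 (f : 'Z_n -> 'Z_n -> A) :
    \sum_i \sum_j (etaX (i * p.1) * 0) *: f i j = 0.
  by rewrite big1 // => i _; rewrite big1 // => j _; rewrite mulr0 scale0r.
have refl0 (f : 'Z_n -> A) : \sum_i (0 : C) *: f i = 0.
  by rewrite big1 // => i _; rewrite scale0r.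
apply/matrixP => a b; rewrite !mxE lift_expand //.
case: a b => [[|[|//]] a_lt2] [[|[|//]] b_lt2] /=.
- under [X in _ + X]eq_bigr do rewrite mxE /=.
  rewrite refl0 addr0; apply: eq_bigr => i _; apply: eq_bigr => j _.
  by rewrite mxE /= etaXD.
- under eq_bigr do under eq_bigr do rewrite mxE /=.
  by rewrite sum0 add0r; apply: eq_bigr => i _; rewrite mxE.
- under eq_bigr do under eq_bigr do rewrite mxE /=.
  by rewrite sum0 add0r; apply: eq_bigr => i _; rewrite mxE.
under [X in _ + X]eq_bigr do rewrite mxE /=.
rewrite refl0 addr0; apply: eq_bigr => i _; apply: eq_bigr => j _.
by rewrite mxE /= etaXD.
Qed.

(** The sign (-1)^j of t_j is well defined modulo n because n is even, and it
    is its own inverse, which is what the relations t_i s_j = s_(j-i) and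
    s_i s_j = t_(j-i) ask for. *)
Lemma dihedral_charM b s : ~~ odd n -> forall x y,
  dihedral_char b s (dmul x y) = dihedral_char b s x *m dihedral_char b s y.
Proof.
move=> n_even [c j] [c' k]; rewrite /dihedral_char -scalar_mxM /=.
congr (_%:M); set z : C := (-1) ^+ b.
have zn1 : z ^+ n = 1.
  by rewrite -exprM mulnC exprM -signr_odd (negPf n_even) expr1n.
have zN (i : 'Z_n) : z ^+ (- i)%R = z ^+ i.
  have zi2 : z ^+ i * z ^+ i = 1 by rewrite -expr2 exprAC sqrr_sign expr1n.
  by rewrite -[LHS]mul1r -zi2 -mulrA unity_exprNr // mulr1.
rewrite mulrACA; congr (_ * _).
  by rewrite -signr_addb; case: (s); case: (c); case: (c').
case: c'; last exact: unity_exprD.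
by rewrite -[z ^+ j]zN mulrC; apply: unity_exprD.
Qed.

Lemma dihedral_char_unitary b s x : dihedral_char b s x \is unitarymx.
Proof.
apply/unitarymxP; rewrite /dihedral_char tr_scalar_mx map_scalar_mx -scalar_mxM.
congr (_%:M); rewrite -normCK !normrM !normrX !normrN !normr1.
by rewrite !expr1n mul1r expr1n.
Qed.

Lemma dihedral_rep2M v x y :
  dihedral_rep2 v (dmul x y) = dihedral_rep2 v x *m dihedral_rep2 v y.
Proof.
apply/matrixP => a b; rewrite !mxE !big_ord_recl big_ord0 !mxE.
case: x y => [[] i] [[] j]; case: a b => [[|[|//]] ?] [[|[|//]] ?] /=;
  rewrite ?mulr0 ?mul0r ?addr0 ?add0r -?etaXD //; congr (Defs.etaX R _); ring.
Qed.

Lemma dihedral_rep2_unitary v x : dihedral_rep2 v x \is unitarymx.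
Proof.
apply/unitarymxP/matrixP => a b; rewrite !mxE !big_ord_recl big_ord0 !mxE.
case: x => [[] i]; case: a b => [[|[|//]] ?] [[|[|//]] ?] /=;
  by rewrite ?conjC0 ?mulr0 ?mul0r ?addr0 ?add0r ?etaX_conj // -?etaXD ?subrr.
Qed.

Lemma dihedral_char1 b s : dihedral_char b s (rotation 0) = 1%:M.
Proof. by rewrite /dihedral_char /= andbF mul1r. Qed.

Lemma dihedral_rep2_1 v : dihedral_rep2 v (rotation 0) = 1%:M.
Proof.
apply/matrixP => a b; rewrite !mxE /= mul0r oppr0 if_same etaX0 addbF.
by case: eqP.
Qed.

Lemma dihedral_char_inj b s b' s' :
  (forall x, dihedral_char b s x = dihedral_char b' s' x) -> (b, s) = (b', s').
Proof.
move=> eq_char.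
have entry x := congr1 (fun M : 'M[C]_1 => M 0 0) (eq_char x).
have -> : b = b'.
  have := entry (rotation 1); rewrite !mxE /= !andbF !mul1r !expr1.
  by move=> /signr_inj.
have := entry (reflection 0); rewrite !mxE /= !andbT !mulr1.
by move=> /signr_inj ->.
Qed.

(** The generator t_1 acts with eigenvalues eta^v, eta^-v on one side and
    eta^v', eta^-v' on the other, so an entry of T vanishes unless the two
    eigenvalues that it relates agree; the reflection s_0 exchanges the two
    basis vectors, hence exchanges the two diagonal entries of T. *)
Lemma dihedral_rep2_intw v v' (T : 'M[C]_2) :
  (forall x, T *m dihedral_rep2 v x = dihedral_rep2 v' x *m T) ->
  [/\ v + v' != 0 -> T 0 1 = 0 /\ T 1 0 = 0,
      v != v' -> T 0 0 = 0 /\ T 1 1 = 0 & T 0 0 = T 1 1].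
Proof.
move=> intw.
have entry x a b := congr1 (fun M : 'M[C]_2 => M a b) (intw x).
have Neq (i j : 'Z_n) (t : C) : i != j -> t * etaX i = etaX j * t -> t = 0.
  move=> ij /eqP; rewrite mulrC -subr_eq0 -mulrBl mulf_eq0 => /orP[|/eqP//].
  by rewrite subr_eq0 => /eqP/(etaX_inj n_gt1)/eqP; rewrite (negPf ij).
have o1 : lift ord0 ord0 = 1 :> 'I_2 by apply/val_inj.
have simp := (mulr0, mul0r, addr0, add0r, o1, @mul1r 'Z_n).
split=> [vv'|vv'|].
- have Nvv' : - v != v' by rewrite eq_sym -addr_eq0 addrC.
  have vNv' : v != - v' by rewrite -addr_eq0.
  split; [move: (entry (rotation 1) 0 1) | move: (entry (rotation 1) 1 0)];
    rewrite !mxE !big_ord_recl !big_ord0 !mxE /= !simp; exact: Neq.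
- have NvNv' : - v != - v' by rewrite (inj_eq oppr_inj).
  split; [move: (entry (rotation 1) 0 0) | move: (entry (rotation 1) 1 1)];
    rewrite !mxE !big_ord_recl !big_ord0 !mxE /= !simp; exact: Neq.
have := entry (reflection 0) 0 1.
by rewrite !mxE !big_ord_recl !big_ord0 !mxE /= !simp oppr0 !etaX0 mulr1 mul1r.
Qed.

End DihedralRep.

Lemma lift_mx_equivalent (R : realType) (n d d' : nat) (u u' : 'Z_n)
    (W : dihedral n -> 'M[R[i]]_d.+1) (W' : dihedral n -> 'M[R[i]]_d'.+1) :
  (1 < n)%N -> W (rotation 0) = 1%:M -> W' (rotation 0) = 1%:M ->
  equivalent (lift_mx u W) (lift_mx u' W') ->
  u = u' /\ exists2 T : 'M[R[i]]_(d'.+1, d.+1),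
    T != 0 & forall x, T *m W x = W' x *m T.
Proof.
move=> n_gt1 W1 W'1 [T [S [TS _ T_intw]]].
have T0 : T != 0.
  by apply: contra_eq_neq TS => ->; rewrite mul0mx eq_sym oner_neq0.
have uu' : u = u' by apply: (intertwines_twist_eq n_gt1 T_intw).
by split=> //; exists T => // x; apply: (intertwines_lift T_intw).
Qed.

(** * The one- and two-dimensional representations *)

Lemma card_X_index n : (1 < n)%N -> ~~ odd n ->
  #|X_index n| = ((n * (n - 2)) %/ 2)%N.
Proof.
move=> n_gt1 n_even.
have -> : X_index n = setX [set: 'Z_n] [set v : 'Z_n | (1 <= v <= n./2 - 1)%N].
  by apply/setP => p; rewrite !inE.
have n2 := odd_double_half n; rewrite (negPf n_even) add0n in n2.
rewrite cardsX cardsT card_Zn // cardsE.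
have -> : #|[pred v : 'Z_n | (1 <= v <= n./2 - 1)%N]| = (n./2 - 1)%N.
  rewrite -sum1_card -(big_mkord (fun v => 1 <= v <= n./2 - 1)%N (fun=> 1%N)).
  rewrite Zp_cast //.
  transitivity (\sum_(1 <= i < n./2) 1)%N.
    rewrite (big_nat_widenl 1 0) // (big_nat_widen 0 n./2 n); last by lia.
    by apply: eq_bigl => i /=; lia.
  by rewrite sum_nat_const_nat muln1.
by rewrite [(n - 2)%N](_ : _ = (n./2 - 1) * 2)%N ?mulnA ?mulnK //; lia.
Qed.

Theorem theorem3p2 (R : realType) (n : nat) (n_ge2 : (2 <= n)%N)
    (n_even : ~~ odd n) :
  [/\ #|{: bool * bool * 'Z_n}| = (4 * n)%N,
      forall p : bool * bool * 'Z_n,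
        is_rep (dim1 (rho_sigma R p)) /\ unitary_mat (dim1 (rho_sigma R p)) &
      forall p q : bool * bool * 'Z_n, p != q ->
        ~ equivalent (dim1 (rho_sigma R p)) (dim1 (rho_sigma R q))]
  /\
  [/\ #|X_index n| = ((n * (n - 2)) %/ 2)%N,
      forall p : 'Z_n * 'Z_n, p \in X_index n ->
        [/\ is_rep (frakX R p), unitary_mat (frakX R p) & irreducible (frakX R p)] &
      forall p q : 'Z_n * 'Z_n, p \in X_index n -> q \in X_index n -> p != q ->
        ~ equivalent (frakX R p) (frakX R q)].
Proof.
(* 0 < v + v' < n for representatives between 1 and n/2 - 1 *)
have X_add_neq0 (p q : 'Z_n * 'Z_n) : p \in X_index n -> q \in X_index n ->
    p.2 + q.2 != 0.
  rewrite !inE => /andP[p_ge1 p_le] /andP[q_ge1 q_le].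
  have n2 := odd_double_half n; rewrite (negPf n_even) add0n in n2.
  have sum_lt : ((p.2 : nat) + (q.2 : nat) < (Zp_trunc n).+2)%N.
    by rewrite [X in (_ < X)%N]Zp_cast //; lia.
  rewrite -val_eqE /= modn_small //.
  by rewrite addn_eq0 negb_and -lt0n p_ge1.
split; split.
- by rewrite !card_prod !card_bool card_Zn.
- move=> [[b s] l]; rewrite -lift_dihedral_char //.
  have W_unitary := @dihedral_char_unitary R n b s.
  split; last exact: lift_mx_unitary.
  by apply: lift_mx_rep => // x y; apply: dihedral_charM.
- move=> [[b s] l] [[b' s'] l'] /eqP pq; rewrite -!lift_dihedral_char // => equiv.
  have [ll' [T T0 intw]] := lift_mx_equivalent n_ge2
    (dihedral_char1 R n b s) (dihedral_char1 R n b' s') equiv.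
  apply: pq; rewrite ll'; congr (_, _); apply: (@dihedral_char_inj R n) => // x.
  move: (intw x); rewrite /dihedral_char mul_mx_scalar mul_scalar_mx => /eqP.
  rewrite -subr_eq0 -scalerBl scaler_eq0 (negPf T0) orbF subr_eq0.
  by move=> /eqP->.
- exact: card_X_index.
- move=> p Xp; rewrite -lift_dihedral_rep2 //.
  have W_unitary := @dihedral_rep2_unitary R n n_ge2 p.2.
  split; last 1 first.
  + move=> T T_intw; exists (T 0 0).
    have [off _ T01] := dihedral_rep2_intw n_ge2
      (fun x => intertwines_lift T_intw x erefl).
    have [T_ur T_dl] := off (X_add_neq0 _ _ Xp Xp).
    by apply: eq_mx2; rewrite mxE.
  + by apply: lift_mx_rep => // x y; apply: dihedral_rep2M.
  exact: lift_mx_unitary.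
move=> p q Xp Xq /eqP pq; rewrite -!lift_dihedral_rep2 // => equiv.
have [pq1 [T /eqP T0 intw]] := lift_mx_equivalent n_ge2
  (dihedral_rep2_1 R p.2) (dihedral_rep2_1 R q.2) equiv.
have [off diag _] := dihedral_rep2_intw n_ge2 intw.
have [T_ur T_dl] := off (X_add_neq0 _ _ Xp Xq).
have pq2 : p.2 != q.2.
  by apply/eqP => pq2; apply: pq; case: (p) (q) pq1 pq2 => [? ?] [? ?] /= -> ->.
have [T_ul T_dr] := diag pq2.
by apply: T0; apply: eq_mx2; rewrite mxE.
Qed.
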